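(* Let $q\in\widetilde{\mathbb C}$ and let $u$ be the symmetrical form such that $\sigma u=\mathcal U$. Then: 1) The recurrence coefficients of the monic orthogonal polynomial sequence of $u$ are, for $n\ge0$, $$\gamma_{2n+1}=-q^{2n},\qquad \gamma_{2n+2}=(1-q^{n+1})q^n .$$ 2) $u$ is regular for any $q\in\widetilde{\mathbb C}$. 3) $u$ is an $H_{\sqrt q}$-semiclassical form of class one satisfying $$H_{\sqrt q}(xu)-(\sqrt q-1)^{-1}(x^2+1)u=0 .$$ 4) The moments of $u$ are $(u)_{2n}=(-1)^nq^{\frac12n(n-1)}$ and $(u)_{2n+1}=0$, $n\ge0$. 5) If $q>1$, then $u$ has the discrete representation $$u=\sum_{k=0}^\infty\frac{(-1)^kq^{-k^2}s(k)}{(q^{-1};q^{-1})_k}\,\frac{\delta_{iq^{k/2}}+\delta_{-iq^{k/2}}}{2},$$ where $s(k)=\sum_{m=0}^\infty\frac{q^{-(\frac12m(m+1)+km)}}{(q^{-1};q^{-1})_k}\,\varepsilon_{m+k}$, with $\varepsilon_{2j}=(q-1)^{j}$ and $\varepsilon_{2j+1}=0$ for $j\ge0$.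
   Context: $\mathcal P$ is the vector space of polynomials in one variable with complex coefficients and $\mathcal P'$ its dual; elements of $\mathcal P'$ are called forms; $\langle u,f\rangle$ is the action of $u$ on $f$ and $(u)_n=\langle u,x^n\rangle$ are the moments. All regular forms are normalized by $(u)_0=1$. A form is symmetrical if $(u)_{2n+1}=0$ for all $n\ge0$. Let $\widetilde{\mathbb C}=\{z\in\mathbb C: z\neq0,\ z^n\neq1\ \forall n\ge1\}$; $\sqrt{\cdot}$ is the principal square root. $(a;q)_0=1$, $(a;q)_n=\prod_{k=1}^n(1-aq^{k-1})$. $\delta_c$ is the form $\langle\delta_c,f\rangle=f(c)$. For a polynomial $g$, $\langle gu,f\rangle=\langle u,gf\rangle$. For $r\in\widetilde{\mathbb C}$, $(H_rf)(x)=\frac{f(rx)-f(x)}{(r-1)x}$ and $\langle H_ru,f\rangle=-\langle u,H_rf\rangle$. The form $\sigma u$ is defined by $\langle\sigma u,f\rangle=\langle u,f(x^2)\rangle$. A form $u$ is regular if there is a sequence of monic polynomials $\{B_n\}_{n\ge0}$, $\deg B_n=n$, with $\langle u,B_mB_n\rangle=r_n\delta_{n,m}$, $r_n\ne0$; then $B_0=1$, $B_1=x-\beta_0$, $B_{n+2}=(x-\beta_{n+1})B_{n+1}-\gamma_{n+1}B_n$ with $\gamma_{n+1}\neq0$, $n\ge0$ (for symmetrical $u$ all $\beta_n=0$). A form $u$ is $H_r$-semiclassical if it is regular and $H_r(\Phi u)+\Psi u=0$ for some polynomials $\Phi$ (monic, degree $t\ge0$) and $\Psi$ (degree $p\ge1$).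 It is of class $s=\max(p-1,t-2)$ if and only if the pair $(\Phi,\Psi)$ satisfies $$\prod_{c\in\mathcal Z_\Phi}\Big\{\big|r\Psi(rc)+(H_r\Phi)(c)\big|+\big|\langle u,\ r(\theta_{cr}\Psi)+\theta_{cr}(\theta_c\Phi)\rangle\big|\Big\}>0,$$ where $\mathcal Z_\Phi$ is the set of zeros of $\Phi$ and $(\theta_cf)(x)=\frac{f(x)-f(c)}{x-c}$. $\mathcal U$ is the form with $(\mathcal U)_0=1$ satisfying $H_q(x\mathcal U)-(q-1)^{-1}(x+1)\mathcal U=0$.
   Formalization: Item 5 is false as printed (q=2, f=1 gives about 1.069, not 1); in s(k) the denominator is corrected to (q^{-1};q^{-1})_m instead of (q^{-1};q^{-1})_k, and ε_{2j} to q^{j(j-1)}∏_{i=1}^{j}(q^{2i-1}-1) instead of (q-1)^j. *)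

(* Defs.v *)
(* MathComp / MathComp-Analysis.  The complex numbers are R[i] for a
   realType R; series converge for the topology of the modulus. *)
From HB Require Import structures.
From mathcomp Require Import all_boot all_order all_algebra.
From mathcomp Require Import complex.
From mathcomp Require Import all_classical all_reals all_analysis.

Set Implicit Arguments.
Unset Strict Implicit.
Unset Printing Implicit Defensive.

Import Order.TTheory GRing.Theory Num.Theory.
Import numFieldNormedType.Exports.

Local Open Scope classical_set_scope.
Local Open Scope ring_scope.
Local Open Scope complex_scope.

Section Forms.
Variable R : realType.
Local Notation C := R[i].
Local Notation form := {scalar {poly C}}.

Definition nonroot (z : C) : Prop :=
  z != 0 /\ forall n : nat, (0 < n)%N -> z ^+ n != 1.

(* Both quotients below are exact divisions. *)
Definition Hop (r : C) (f : {poly C}) : {poly C} :=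
  (f \Po (r *: 'X) - f) %/ ((r - 1) *: 'X).

Definition theta (c : C) (f : {poly C}) : {poly C} :=
  (f - f.[c]%:P) %/ ('X - c%:P).

Lemma Hop_linear r : linear (Hop r).
Proof.
move=> a f g; rewrite /Hop comp_polyD comp_polyZ.
by rewrite opprD addrACA -scalerBr divpD divpZl.
Qed.

Definition mul_form_fun (g : {poly C}) (u : form) (f : {poly C}) : C :=
  u (g * f).

Lemma mul_form_is_scalar g u : scalar (mul_form_fun g u).
Proof. by move=> a f h; rewrite /mul_form_fun mulrDr -scalerAr linearP. Qed.

HB.instance Definition _ g u :=
  GRing.isLinear.Build C {poly C} C *%R (mul_form_fun g u)
    (mul_form_is_scalar g u).

Definition mul_form g u : form := mul_form_fun g u.

Definition H_form_fun (r : C) (u : form) (f : {poly C}) : C := - u (Hop r f).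

Lemma H_form_is_scalar r u : scalar (H_form_fun r u).
Proof.
by move=> a f h; rewrite /H_form_fun Hop_linear linearP opprD mulrN.
Qed.

HB.instance Definition _ r u :=
  GRing.isLinear.Build C {poly C} C *%R (H_form_fun r u)
    (H_form_is_scalar r u).

Definition H_form r u : form := H_form_fun r u.

Definition sigma_form_fun (u : form) (f : {poly C}) : C := u (f \Po 'X^2).

Lemma sigma_form_is_scalar u : scalar (sigma_form_fun u).
Proof.
by move=> a f h; rewrite /sigma_form_fun comp_polyD comp_polyZ linearP.
Qed.

HB.instance Definition _ u :=
  GRing.isLinear.Build C {poly C} C *%R (sigma_form_fun u)
    (sigma_form_is_scalar u).

Definition sigma_form u : form := sigma_form_fun u.

Definition moment (u : form) (n : nat) : C := u 'X^n.

Definition symmetrical (u : form) : Prop :=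
  forall n : nat, moment u n.*2.+1 = 0.

Definition is_MOPS (u : form) (B : nat -> {poly C}) : Prop :=
  (forall n, B n \is monic /\ size (B n) = n.+1) /\
  exists2 rho : nat -> C, (forall n, rho n != 0) &
    forall m n, u (B m * B n) = if m == n then rho n else 0.

Definition regular (u : form) : Prop := exists B, is_MOPS u B.

(* gamma 0 is not used. *)
Definition recurrence (B : nat -> {poly C}) (beta gamma : nat -> C) : Prop :=
  [/\ B 0%N = 1,
      B 1%N = 'X - (beta 0%N)%:P &
      forall n, B n.+2 =
        ('X - (beta n.+1)%:P) * B n.+1 - (gamma n.+1)%:P * B n].

(* H_r(Phi u) + Psi u = 0 *)
Definition H_equation (r : C) (u : form) (Phi Psi : {poly C}) : Prop :=
  forall f, H_form r (mul_form Phi u) f + mul_form Psi u f = 0.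

Definition class_condition (r : C) (u : form) (Phi Psi : {poly C}) : Prop :=
  0 < \big[*%R/1]_(c \in [set c | root Phi c])
        (`|r * Psi.[r * c] + (Hop r Phi).[c]|
         + `|u (r *: theta (c * r) Psi + theta (c * r) (theta c Phi))|).

(* The degrees are t = (size Phi).-1 and p = (size Psi).-1; since p >= 1, the
   truncated differences give the same maximum as the integer ones. *)
Definition semiclassical_of_class (r : C) (u : form) (Phi Psi : {poly C})
    (s : nat) : Prop :=
  [/\ regular u,
      Phi \is monic /\ (1 < size Psi)%N,
      H_equation r u Phi Psi,
      s = maxn ((size Psi).-1 - 1) ((size Phi).-1 - 2) &
      class_condition r u Phi Psi].

Definition qpoch (a q : C) (n : nat) : C :=
  \prod_(1 <= k < n.+1) (1 - a * q ^+ k.-1).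

(* epsilon_(2j) = q^(j(j-1)) prod_(1 <= i <= j) (q^(2i-1) - 1) and
   epsilon_(2j+1) = 0.  With the weights below, the identity for the moment of
   index 2n reads \sum_j (-1)^j [n, j]_q epsilon_j = q^(n(n-1)/2), where
   [n, j]_q is the Gaussian binomial; these identities determine epsilon.
   Setting epsilon_(2j) = (q - 1)^j instead would satisfy them for n <= 3 but
   not for n = 4. *)
Definition epsilon (q : C) (n : nat) : C :=
  if odd n then 0
  else q ^+ (n./2 * (n./2 - 1)) * \prod_(1 <= i < n./2.+1) (q ^+ (i.*2 - 1) - 1).

(* The denominator is (q^-1; q^-1)_m, with the summation index m. *)
Definition s_term (q : C) (k m : nat) : C^o :=
  q ^- ((m * (m + 1))./2 + k * m) / qpoch q^-1 q^-1 m * epsilon q (m + k).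

Definition s_sum (q : C) (k : nat) : C^o := limn (series (s_term q k)).

Definition weight (q : C) (k : nat) : C :=
  (-1) ^+ k * q ^- (k ^ 2) * s_sum q k / qpoch q^-1 q^-1 k.

(* <(delta_c + delta_(-c)) / 2, f> at c = i q^(k/2), with q^(k/2) = sqrt(q)^k *)
Definition symmetric_dirac (q : C) (k : nat) (f : {poly C}) : C :=
  (f.['i * sqrtc q ^+ k] + f.[- ('i * sqrtc q ^+ k)]) / 2.

Definition discrete_term (q : C) (f : {poly C}) (k : nat) : C^o :=
  weight q k * symmetric_dirac q k f.

End Forms.

(* Main.v *)
Require Import Defs.
From mathcomp Require Import all_boot all_order all_algebra.
From mathcomp Require Import complex ring lra zify.
From mathcomp Require Import all_classical all_reals all_analysis.
Import Order.TTheory GRing.Theory Num.Theory.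
Import numFieldNormedType.Exports.
Local Open Scope classical_set_scope.
Local Open Scope ring_scope.
Local Open Scope complex_scope.

(** The functional equation of [U] is a first-order recurrence for its moments,
    [(U)_(n+1) = - q^n (U)_n], so that [(U)_n = (-1)^n q^C(n,2)]. Symmetry and
    [sigma u = U] then give all the moments of [u], and the equation of [u] for
    [r = sqrt q], once translated into moments ([H_equation_moments]), follows
    from [r^2 = q].

    Orthogonality rests on [C(k+m,2) = C(k,2) + C(m,2) + k m]: the pairing under
    [U] of [x^m] with a polynomial of coefficients [c_k] is, up to a nonzero
    factor, the value at [q^m] of the polynomial with coefficients
    [(-1)^k q^C(k,2) c_k]. A polynomial of degree [n] is thus orthogonal to the
    lower powers exactly when the transformed one has the roots
    [1, q, ..., q^(n-1)] ([opoly_pairing]); for [x U] the roots are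
    [q, ..., q^n]. As [q] is not a root of unity, these roots are distinct from
    the next node, and the norms, which are products of differences of nodes,
    do not vanish. Substituting [x^2] gives the orthogonal polynomials of [u];
    they are the only ones ([MOPS_unique]), and the coefficients [gamma] are the
    quotients of consecutive norms ([MOPS_recurrence]).

    For the discrete representation, take [q > 1] and [p = q^-1]. By linearity
    it suffices to test monomials, where the odd ones give [0]. The even
    monomial [x^(2n)] gives a double series, over the mass points [k] and over
    the index [m] of the series [s(k)]. On a diagonal [m + k = N] it sums, by
    the q-binomial theorem, to a multiple of [(q^n; p)_N], which is [0] for
    [N > n]. The remaining finite sum is a q-Chu-Vandermonde sum; here a
    telescoping identity shows that it gets multiplied by [q^n] when [n] becomes
    [n + 1] ([even_sum_shift]), hence that it equals [q^C(n,2)]. Finally, the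
    terms are bounded by [D p^(2k+m)] ([moment_term_le]), and this allows the
    sum over triangles to be replaced by the iterated sum
    ([iterated_series_cvg]). *)

Set Implicit Arguments.
Unset Strict Implicit.

(** * Binomial coefficients of order two *)

Lemma bin2S n : 'C(n.+1, 2) = ('C(n, 2) + n)%N.
Proof. by rewrite binS bin1. Qed.

Lemma bin2D m n : 'C(m + n, 2) = ('C(m, 2) + 'C(n, 2) + m * n)%N.
Proof.
elim: n => [|n IHn]; first by rewrite addn0 muln0 !addn0.
by rewrite addnS !bin2S IHn; lia.
Qed.

Lemma sqr_bin2 k : (k ^ 2 = 'C(k, 2) + 'C(k.+1, 2))%N.
Proof.
elim: k => // k IHk; rewrite bin2S -addn1 sqrnD IHk muln1 exp1n !addn1 !bin2S; lia.
Qed.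

(** * Orthogonal polynomial sequences of a form *)

Section OrthogonalPolynomials.
Variable R : realType.
Local Notation C := R[i].
Implicit Types (u : {scalar {poly C}}) (B E : nat -> {poly C}) (p : {poly C}).

Lemma formZ u a p : u (a *: p) = a * u p.
Proof. exact: linearZ. Qed.

Lemma monic_coef_top p n : p \is monic -> size p = n.+1 -> p`_n = 1.
Proof. by move=> /monicP mp sp; rewrite -mp lead_coefE sp. Qed.

Lemma size_sub_lead_le p (b : {poly C}) n :
  (size p <= n.+1)%N -> b \is monic -> size b = n.+1 ->
  (size (p - p`_n *: b)%R <= n)%N.
Proof.
move=> sp mb sb; apply/leq_sizeP => j; rewrite leq_eqVlt coefB coefZ.
case/predU1P=> [<-|nj].
  by rewrite (monic_coef_top mb sb) mulr1 subrr.
by rewrite (nth_default _ (leq_trans sp nj))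
  (@nth_default _ 0 b) ?sb // mulr0 subrr.
Qed.

(** The polynomials [B_m] with [m < n] span the polynomials of degree less than
    [n]: subtract multiples of [B_k] to kill leading terms. *)
Lemma MOPS_orth_lt u B p n : is_MOPS u B -> (size p <= n)%N -> u (p * B n) = 0.
Proof.
case=> mB [rho _ uBB].
suff H k : (k <= n)%N -> forall p, (size p <= k)%N -> u (p * B n) = 0.
  exact: H.
elim: k => [|k IHk] kn {}p sp.
  by move: sp; rewrite leqn0 size_poly_eq0 => /eqP->; rewrite mul0r linear0.
have [mk sk] := mB k.
rewrite -(subrK (p`_k *: B k) p) mulrDl linearD -scalerAl formZ uBB.
by rewrite (ltn_eqF kn) /= mulr0 addr0 IHk ?size_sub_lead_le // ltnW.
Qed.

Lemma MOPS_orth_eq u B p n :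
  is_MOPS u B -> (size p <= n.+1)%N -> u (p * B n) = p`_n * u (B n * B n).
Proof.
move=> MB sp; have [/(_ n)[mn sn] _] := MB.
rewrite -[in LHS](subrK (p`_n *: B n) p) mulrDl linearD /=.
by rewrite (MOPS_orth_lt MB) ?size_sub_lead_le // add0r -scalerAl formZ.
Qed.

Lemma MOPS_norm_neq0 u B n : is_MOPS u B -> u (B n * B n) != 0.
Proof. by case=> _ [rho rho0 ->]; rewrite eqxx. Qed.

(** Pairing a polynomial of degree [d] with [B_d] gives its leading coefficient
    times a nonzero norm. This is how equalities of polynomials are established
    below. *)
Lemma MOPS_nondegenerate u B p n :
  is_MOPS u B -> (size p <= n)%N ->
  (forall m, (m < n)%N -> u (p * B m) = 0) -> p = 0.
Proof.
move=> MB sp uB; apply/eqP/negPn/negP => p0.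
have sd : size p = (size p).-1.+1 by rewrite prednK ?size_poly_gt0.
have := uB (size p).-1; rewrite -[X in (X <= n)%N]sd => /(_ sp)/eqP.
rewrite (MOPS_orth_eq MB) -?sd // mulf_eq0 (negPf (MOPS_norm_neq0 _ MB)) orbF.
by rewrite -lead_coefE lead_coef_eq0 (negPf p0).
Qed.

Lemma MOPS_unique u B E : is_MOPS u B -> is_MOPS u E -> B =1 E.
Proof.
move=> MB ME n; have [[mB _] [mE _]] := (MB, ME).
have [[mBn sBn] [mEn sEn]] := (mB n, mE n).
apply/eqP; rewrite -subr_eq0; apply/eqP/(MOPS_nondegenerate MB (n := n)).
  have := @size_sub_lead_le (B n) (E n) n; rewrite sBn leqnn => /(_ isT mEn sEn).
  by rewrite (monic_coef_top mBn sBn) scale1r.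
move=> m mn; have [_ sm] := mB m; rewrite mulrBl linearB /= ![_ * B m]mulrC.
by rewrite (MOPS_orth_lt MB) ?sm // (MOPS_orth_lt ME) ?sm // subrr.
Qed.

(** Pairings with monomials are what the closed form of the moments makes
    computable; by triangularity they determine all pairings of the [B_n]. *)
Lemma MOPS_of_powers u B (rho : nat -> C) :
  (forall n, B n \is monic /\ size (B n) = n.+1) ->
  (forall n, rho n != 0) ->
  (forall m n, (m <= n)%N -> u ('X^m * B n) = if m == n then rho n else 0) ->
  is_MOPS u B /\ forall n, u (B n * B n) = rho n.
Proof.
move=> mB rho0 uX.
have low p n : (size p <= n.+1)%N -> u (p * B n) = p`_n * rho n.
  move=> sp; rewrite -[p in LHS](take_poly_id sp) /take_poly poly_def.
  rewrite big_distrl linear_sum big_ord_recr /=.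
  rewrite -scalerAl formZ uX // eqxx /= big1 ?add0r // => i _.
  by rewrite -scalerAl formZ uX ?(ltnW (ltn_ord i)) // (ltn_eqF (ltn_ord i)) mulr0.
have lc n : (B n)`_n = 1 by have [mn sn] := mB n; exact: monic_coef_top.
have lt m n : (m < n)%N -> u (B m * B n) = 0.
  move=> mn; have [_ sm] := mB m.
  by rewrite low ?nth_default ?mul0r // sm // ltnS ltnW.
have eq n : u (B n * B n) = rho n.
  by have [_ sn] := mB n; rewrite low ?sn // lc mul1r.
split=> //; split=> //; exists rho => // m n.
have [mn|nm|->] := ltngtP m n; [exact: lt| |exact: eq].
by rewrite mulrC lt.
Qed.

(** The vanishing of [<u, x B_n^2>], which symmetry provides, is the vanishing
    of the diagonal recurrence coefficients; the others are ratios of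
    consecutive norms. *)
Lemma MOPS_recurrence u B :
  is_MOPS u B -> (forall n, u ('X * (B n * B n)) = 0) ->
  recurrence B (fun=> 0) (fun n => u (B n * B n) / u (B n.-1 * B n.-1)).
Proof.
move=> MB uXBB; have [mB _] := MB.
have sX n : size ('X * B n) = n.+2.
  have [mn sn] := mB n; rewrite size_monicM ?monicX -?size_poly_eq0 ?sn //.
  by rewrite size_polyX.
have lc n : (B n)`_n = 1 by have [mn sn] := mB n; exact: monic_coef_top.
have cX n : ('X * B n)`_n.+1 = 1 by rewrite mulrC coefMX lc.
have B0 : B 0%N = 1.
  have [_ s0] := mB 0%N; have /eqP/size_poly1P[c c0 e] := s0.
  by have := lc 0%N; rewrite e coefC /= => ->.
split=> [//||n].
  rewrite polyC0 subr0; have [m1 s1] := mB 1%N.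
  apply/eqP; rewrite eq_sym -subr_eq0; apply/eqP/(MOPS_nondegenerate MB (n := 1%N)).
    by have := @size_sub_lead_le 'X (B 1%N) 1; rewrite coefX scale1r size_polyX; apply.
  case=> // _; rewrite mulrBl linearB /= [B 1%N * _]mulrC.
  rewrite (MOPS_orth_lt MB (n := 1%N)) ?B0 ?size_poly1 // mulr1 subr0.
  by have := uXBB 0%N; rewrite B0 !mulr1.
rewrite polyC0 subr0 /=; set g := _ / _.
have [mn2 sn2] := mB n.+2; have [mn1 sn1] := mB n.+1; have [mn sn] := mB n.
apply/eqP; rewrite eq_sym -subr_eq0; apply/eqP/(MOPS_nondegenerate MB (n := n.+2)).
  rewrite addrAC; apply: leq_trans (size_polyD _ _) _; rewrite geq_max.
  have := @size_sub_lead_le ('X * B n.+1) (B n.+2) n.+2.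
  rewrite cX scale1r sX leqnn => -> //=; rewrite size_polyN mul_polyC.
  by apply: leq_trans (size_scale_leq _ _) _; rewrite sn ltnW.
move=> m; rewrite ltnS => mn'; have [_ sm] := mB m.
rewrite !mulrBl !linearB /= [B n.+2 * _]mulrC.
rewrite (@MOPS_orth_lt _ _ (B m) n.+2 MB) ?sm // subr0.
rewrite mulrAC mul_polyC -scalerAl formZ /=.
have uB k l : (k < l)%N -> u (B l * B k) = 0.
  by move=> kl; have [_ sk] := mB k; rewrite mulrC (MOPS_orth_lt MB) ?sk.
move: mn'; rewrite leq_eqVlt => /predU1P[->|].
  rewrite (mulrC (B n)) uB // mulr0 subr0 -mulrA.
  by rewrite uXBB.
rewrite ltnS leq_eqVlt => /predU1P[->|mn'].
  rewrite (MOPS_orth_eq MB) ?sX // cX mul1r /g mulfVK ?subrr //.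
  exact: MOPS_norm_neq0 MB.
by rewrite (MOPS_orth_lt MB) ?sX // uB // mulr0 subrr.
Qed.
End OrthogonalPolynomials.

(** * Functional equations and moments *)

Section Moments.
Variable R : realType.
Local Notation C := R[i].
Implicit Types (q r : C) (u U : {scalar {poly C}}) (g : {poly C}).

Lemma mulX_Hop_Xn r n :
  r != 1 -> 'X * Hop r 'X^n = ((r ^+ n - 1) / (r - 1)) *: 'X^n.
Proof.
move=> r1; have r10 : r - 1 != 0 by rewrite subr_eq0.
rewrite /Hop comp_Xn_poly exprZn -[X in _ - X]scale1r -scalerBl.
case: n => [|n]; first by rewrite subrr !scale0r div0p mulr0 mul0r scale0r.
have -> : (r ^+ n.+1 - 1) *: 'X^(n.+1) =
  (((r ^+ n.+1 - 1) / (r - 1)) *: 'X^n) * ((r - 1) *: 'X) :> {poly C}.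
  by rewrite -scalerAl -scalerAr scalerA mulfVK // -exprSr.
by rewrite mulpK ?scaler_eq0 ?negb_or ?r10 ?polyX_eq0 // -scalerAr -exprS.
Qed.

(** Both functional equations at stake have this shape, with [g = x] and
    [g = x^2]; on the monomial [x^n] the [H_r]-derivative contributes,
    up to the common factor, [(r^n - 1) (u)_n], in which [-1] cancels the [1]
    of [g + 1]. *)
Lemma H_equation_moments r u g : r != 1 ->
  H_equation r u 'X (- ((r - 1)^-1 *: (g + 1))) <->
  forall n, u (g * 'X^n) = - r ^+ n * moment u n.
Proof.
move=> r1; have r10 : r - 1 != 0 by rewrite subr_eq0.
have E n : H_form r (mul_form 'X u) 'X^n
    + mul_form (- ((r - 1)^-1 *: (g + 1))) u 'X^n =
    - (r - 1)^-1 * (u (g * 'X^n) + r ^+ n * moment u n).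
  rewrite [LHS](_ : _ = - u ('X * Hop r 'X^n)
    + u (- ((r - 1)^-1 *: (g + 1)) * 'X^n)) // mulX_Hop_Xn // formZ.
  rewrite mulNr linearN -(scalerAl _ (g + 1)) formZ (mulrDl g) mul1r linearD /=.
  rewrite -/(moment u n).
  by field.
split=> [uH n|uX f].
  have := uH 'X^n; rewrite E => /eqP; rewrite mulf_eq0 oppr_eq0 invr_eq0.
  by rewrite (negPf r10) addr_eq0 mulNr => /eqP.
rewrite -(coefK f) poly_def !linear_sum -big_split big1 // => i _ /=.
by rewrite !formZ -mulrDr E uX; ring.
Qed.

Lemma moment_U q U : q != 1 -> moment U 0 = 1 ->
  H_equation q U 'X (- ((q - 1)^-1 *: ('X + 1))) ->
  forall n, moment U n = (-1) ^+ n * q ^+ 'C(n, 2).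
Proof.
move=> q1 U0 /(H_equation_moments _ _ q1) UX.
elim=> [|n IHn]; first by rewrite U0 mulr1.
rewrite /moment exprS UX IHn bin2S exprD exprS; ring.
Qed.

Lemma moment_sigma u U n : sigma_form u =1 U -> moment u n.*2 = moment U n.
Proof.
by move=> sU; rewrite /moment -sU /sigma_form /= /sigma_form_fun comp_Xn_poly
  -exprM mul2n.
Qed.

Lemma symmetric_equation q r u U : r != 1 -> r ^+ 2 = q -> symmetrical u ->
  sigma_form u =1 U ->
  (forall n, moment U n = (-1) ^+ n * q ^+ 'C(n, 2)) ->
  H_equation r u 'X (- ((r - 1)^-1 *: ('X^2 + 1))).
Proof.
move=> r1 rq su sU mU; apply/H_equation_moments => // n.
rewrite -exprD -/(moment _ _) -(odd_double_half n).
case: (odd n) => /=; first by rewrite add1n add2n -doubleS !su mulr0.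
rewrite add0n add2n -doubleS !(moment_sigma _ sU) !mU bin2S exprD exprS.
rewrite -[n./2.*2]mul2n exprM rq; ring.
Qed.

(** The only zero of [x] is [0], where the first summand of the class condition
    is [|(r - 1)^-1|]. *)
Lemma symmetric_class r u : r != 1 ->
  class_condition r u 'X (- ((r - 1)^-1 *: ('X^2 + 1))).
Proof.
move=> r1; have r10 : r - 1 != 0 by rewrite subr_eq0.
rewrite /class_condition.
have -> : [set c : C | root 'X c] = [set 0].
  by apply/seteqP; split=> c /=; rewrite rootX => /eqP.
rewrite fsbig_set1 ltr_wpDr // normr_gt0 mulr0.
have -> : Hop r 'X = 1.
  have := mulX_Hop_Xn 1 r1; rewrite expr1 divff // scale1r.
  by move=> /(congr1 (fun p => p %/ 'X)); rewrite mulrC mulpK ?divpp ?polyX_eq0.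
rewrite hornerC hornerN hornerZ hornerD hornerXn hornerC expr0n add0r mulr1.
have -> : r * - (r - 1)^-1 + 1 = - (r - 1)^-1 by field.
by rewrite oppr_eq0 invr_eq0.
Qed.
End Moments.

(** * Explicit orthogonal polynomials *)

Section ExplicitPolynomials.
Variable R : realType.
Local Notation C := R[i].
Implicit Types (q : C) (u U : {scalar {poly C}}).

Definition node_poly q a n : {poly C} := \prod_(j < n) ('X - (q ^+ (j + a))%:P).

(** The monic orthogonal polynomial of degree [n] for the form [x^a U]. Its
    coefficients are those of [node_poly] rescaled so that, up to a factor free
    of [k], the moment of order [k + m + a] multiplies the coefficient of index
    [k] by [q^(k (m + a))]: see [opoly_pairing]. *)
Definition opoly q a n : {poly C} :=
  \poly_(k < n.+1)
    ((-1) ^+ (n + k) * q ^+ 'C(n, 2) / q ^+ 'C(k, 2) * (node_poly q a n)`_k).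

Lemma size_node_poly q a n : size (node_poly q a n) = n.+1.
Proof. by rewrite /node_poly size_prod_XsubC /index_enum -enumT size_enum_ord. Qed.

Lemma node_poly_lead q a n : (node_poly q a n)`_n = 1.
Proof.
exact: monic_coef_top (monic_prod_XsubC _ _ _) (size_node_poly q a n).
Qed.

Lemma opoly_lead q a n : q != 0 -> (opoly q a n)`_n = 1.
Proof.
move=> q0; rewrite coef_poly ltnSn node_poly_lead mulr1 mulfK ?expf_neq0 //.
by rewrite -signr_odd addnn odd_double.
Qed.

Lemma size_opoly q a n : q != 0 -> size (opoly q a n) = n.+1.
Proof.
by move=> q0; apply: size_poly_eq; have := opoly_lead a n q0;
   rewrite coef_poly ltnSn => ->; rewrite oner_neq0.
Qed.

(** Since [C(m + a + k, 2) = C(m + a, 2) + C(k, 2) + (m + a) k], pairing with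
    [x^(m + a)] turns into evaluating the node polynomial at [q^(m + a)]. Hence
    orthogonality to lower powers says that [q^a, ..., q^(a + n - 1)] are its
    roots. *)
Lemma opoly_pairing q U a m n : q != 0 ->
  (forall k, moment U k = (-1) ^+ k * q ^+ 'C(k, 2)) ->
  U ('X^(m + a) * opoly q a n) =
  (-1) ^+ (n + m + a) * q ^+ ('C(n, 2) + 'C(m + a, 2))
    * (node_poly q a n).[q ^+ (m + a)].
Proof.
move=> q0 mU; rewrite /opoly poly_def mulr_sumr linear_sum /=.
rewrite (horner_coef_wide (n := n.+1)) ?size_node_poly // mulr_sumr.
apply: eq_bigr => k _; rewrite -scalerAr formZ -exprD -/(moment _ _) mU.
have -> : 'C(m + a + k, 2) = ('C(m + a, 2) + 'C(k, 2) + (m + a) * k)%N.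
  exact: bin2D.
have qk : q ^+ 'C(k, 2) != 0 by rewrite expf_neq0.
have := sqrr_sign C k; rewrite expr2 => sk.
rewrite !(exprD q) [q ^+ (_ * k)]exprM !(exprD (-1)).
rewrite -!(exprD q m a); set x := (q ^+ (m + a)) ^+ k; set y := q ^+ 'C(m + a, 2).
transitivity ((-1) ^+ k * (-1) ^+ k * ((-1) ^+ n * (-1) ^+ m * (-1) ^+ a
  * (q ^+ 'C(n, 2) * y) * ((node_poly q a n)`_k * x))); last by rewrite sk mul1r.
by field.
Qed.

Lemma node_polyE q a n :
  (node_poly q a n).[q ^+ (n + a)] = \prod_(j < n) (q ^+ (n + a) - q ^+ (j + a)).
Proof. by rewrite horner_prod; apply: eq_bigr => j _; rewrite hornerXsubC. Qed.

Lemma node_poly_shift q n :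
  (node_poly q 1 n).[q ^+ (n + 1)] = q ^+ n * (node_poly q 0 n).[q ^+ (n + 0)].
Proof.
rewrite !node_polyE -[in q ^+ n](card_ord n) -prodr_const -big_split /=.
by apply: eq_bigr => j _; rewrite !addn1 !addn0 !exprS mulrBr.
Qed.

Lemma node_poly_succ q n :
  (node_poly q 0 n.+1).[q ^+ (n.+1 + 0)] =
  (q ^+ n.+1 - 1) * (node_poly q 1 n).[q ^+ (n + 1)].
Proof.
rewrite !node_polyE big_ord_recl /= add0n addn0 addn1; congr (_ * _).
by apply: eq_bigr => j _; rewrite /= /bump /= add1n addn0 addn1.
Qed.

Lemma node_poly_neq0 q a n :
  nonroot q -> (node_poly q a n).[q ^+ (n + a)] != 0.
Proof.
case=> q0 qn; rewrite node_polyE prodf_seq_neq0; apply/allP => j _ /=.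
rewrite -{1}(subnK (ltnW (ltn_ord j))) -addnA exprD -{2}[q ^+ (j + a)]mul1r.
by rewrite -mulrBl mulf_neq0 ?expf_neq0 // subr_eq0 qn // subn_gt0.
Qed.

Lemma node_poly_root q a m n :
  (m < n)%N -> (node_poly q a n).[q ^+ (m + a)] = 0.
Proof.
move=> mn; rewrite /node_poly horner_prod (bigD1 (Ordinal mn)) //=.
by rewrite hornerXsubC subrr mul0r.
Qed.

Lemma symmetrical_odd u (g : {poly C}) : symmetrical u -> u ('X * (g \Po 'X^2)) = 0.
Proof.
move=> su; rewrite -(coefK g) poly_def !linear_sum /= mulr_sumr linear_sum.
rewrite big1 // => i _; rewrite comp_polyZ comp_Xn_poly -scalerAr formZ.
by rewrite -exprM -exprS -/(moment u _) mul2n su mulr0.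
Qed.

(** Quadratic decomposition: the orthogonal polynomials of a symmetrical form
    [u] of even degree are those of [sigma u] at [x^2], and those of odd degree
    are [x] times those of [x sigma u] at [x^2]. *)
Definition sympoly q n : {poly C} :=
  'X^(odd n) * (opoly q (odd n) n./2 \Po 'X^2).

Definition symnorm q n : C :=
  (-1) ^+ (odd n) * q ^+ ('C(n./2, 2) + 'C(n./2 + odd n, 2))
    * (node_poly q (odd n) n./2).[q ^+ (n./2 + odd n)].

Lemma sympoly_monic q n :
  q != 0 -> sympoly q n \is monic /\ size (sympoly q n) = n.+1.
Proof.
move=> q0; have sX2 : (1 < size ('X^2 : {poly C}))%N by rewrite size_polyXn.
have mo : opoly q (odd n) n./2 \is monic.
  by rewrite monicE lead_coefE size_opoly // opoly_lead.
have mc : opoly q (odd n) n./2 \Po 'X^2 \is monic.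
  by rewrite monicE lead_coef_comp // (monicP mo) lead_coefXn expr1n mulr1.
split; first by rewrite monicMl ?monicXn.
rewrite size_monicM ?monicXn ?monic_neq0 // size_polyXn.
rewrite (polySpred (monic_neq0 mc)) size_comp_poly size_opoly // size_polyXn.
by rewrite /= muln2 addnS /= odd_double_half.
Qed.

Lemma sympoly_pairing q u U m n : q != 0 ->
  symmetrical u -> sigma_form u =1 U ->
  (forall k, moment U k = (-1) ^+ k * q ^+ 'C(k, 2)) ->
  (m <= n)%N ->
  u ('X^m * sympoly q n) = if m == n then symnorm q n else 0.
Proof.
move=> q0 su sU mU mn.
have uU p : u (p \Po 'X^2) = U p by rewrite -sU.
rewrite /sympoly mulrA -exprD.
have [omn|omn] := boolP (odd m == odd n); last first.
  (* When the parities differ, the product is odd. *)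
  have -> : (m + odd n)%N = ((m + odd n)./2 * 2).+1 by lia.
  rewrite exprS mulnC exprM -mulrA -comp_Xn_poly -comp_polyM symmetrical_odd //.
  by case: (eqVneq m n) omn => [->|//]; rewrite eqxx.
have -> : (m + odd n)%N = (2 * (m./2 + odd n))%N by lia.
rewrite exprM -comp_Xn_poly -comp_polyM uU (opoly_pairing _ _ _ q0 mU).
have [->|nmn] := eqVneq m n.
  by rewrite addnn exprD -signr_odd odd_double mul1r.
have mn2 : (m./2 < n./2)%N by move/eqP: omn => omn; lia.
by rewrite node_poly_root ?mulr0.
Qed.

Lemma sympoly_MOPS q u U : nonroot q ->
  symmetrical u -> sigma_form u =1 U ->
  (forall k, moment U k = (-1) ^+ k * q ^+ 'C(k, 2)) ->
  is_MOPS u (sympoly q) /\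
  forall n, u (sympoly q n * sympoly q n) = symnorm q n.
Proof.
move=> hq su sU mU; have [q0 _] := hq; apply: MOPS_of_powers => [n|n|m n].
- exact: sympoly_monic.
- by rewrite !mulf_neq0 ?expf_neq0 ?oppr_eq0 ?oner_neq0 ?node_poly_neq0.
- by move=> mn; rewrite (sympoly_pairing q0 su sU mU mn).
Qed.

Lemma sympoly_parity q u n :
  symmetrical u -> u ('X * (sympoly q n * sympoly q n)) = 0.
Proof.
move=> su; rewrite /sympoly mulrACA -exprD addnn -mul2n exprM -(comp_Xn_poly 'X^2).
by rewrite -!comp_polyM symmetrical_odd.
Qed.

Lemma symnorm_odd q n : nonroot q ->
  symnorm q n.*2.+1 / symnorm q n.*2 = - q ^+ (2 * n).
Proof.
move=> hq; have [q0 _] := hq.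
rewrite /symnorm /= odd_double /= uphalf_double doubleK node_poly_shift.
move: (_.[_]) (node_poly_neq0 0 n hq) => v v0.
rewrite mul2n -addnn addn1 addn0 bin2S expr1 expr0 !exprD.
have qn := expf_neq0 n q0; have qc := expf_neq0 'C(n, 2) q0.
by field; rewrite v0 qc.
Qed.

Lemma symnorm_even q n : nonroot q ->
  symnorm q n.+1.*2 / symnorm q n.*2.+1 = (1 - q ^+ n.+1) * q ^+ n.
Proof.
move=> hq; have [q0 _] := hq.
rewrite /symnorm odd_double /= odd_double /= uphalf_double doubleK node_poly_succ.
move: (_.[_]) (node_poly_neq0 1 n hq) => v v0.
rewrite addn1 addn0 bin2S expr1 expr0 !exprD.
have qn := expf_neq0 n q0; have qc := expf_neq0 'C(n, 2) q0.
by field; rewrite v0 qn qc.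
Qed.

End ExplicitPolynomials.

(** * Finite q-series identities *)

Section QSeries.
Variable R : realType.
Local Notation C := R[i].
Implicit Types (a p q x : C).

Lemma qpoch0 a p : qpoch a p 0 = 1.
Proof. by rewrite /qpoch big_nil. Qed.

Lemma qpochS a p n : qpoch a p n.+1 = qpoch a p n * (1 - a * p ^+ n).
Proof. by rewrite /qpoch big_nat_recr. Qed.

Lemma qpochSl a p n : p != 0 -> qpoch (a / p) p n.+1 = (1 - a / p) * qpoch a p n.
Proof.
move=> p0; elim: n => [|n IHn]; first by rewrite qpochS !qpoch0 mulr1 mulr1 mul1r.
by rewrite qpochS IHn qpochS exprS mulrA divfK // mulrA.
Qed.

Lemma qpoch_neq0 p n :
  (forall k, (0 < k)%N -> 1 - p ^+ k != 0) -> qpoch p p n != 0.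
Proof.
move=> p1; elim: n => [|n IHn]; first by rewrite qpoch0 oner_neq0.
by rewrite qpochS mulf_neq0 // -exprS p1.
Qed.

(** Divided by the common factor [(p; p)_n], this is Gauss' q-binomial theorem.
    The induction uses the q-Pascal rule in the form
    [1 - p^(n+1) = (1 - p^(n+1-k)) + p^(n+1-k) (1 - p^k)]. *)
Lemma q_binomial p x n : (forall k, (0 < k)%N -> 1 - p ^+ k != 0) ->
  \sum_(k < n.+1) (-1) ^+ k * p ^+ 'C(k, 2) * x ^+ k
     / (qpoch p p k * qpoch p p (n - k)) = qpoch x p n / qpoch p p n.
Proof.
move=> p1; have P0 k := qpoch_neq0 k p1.
elim: n => [|n IHn].
  by rewrite big_ord1 /= !qpoch0 !expr0 !mul1r.
have pn := p1 n.+1 isT.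
rewrite (qpochS x) (qpochS p) -exprS; apply: (mulfI pn).
transitivity ((1 - x * p ^+ n) * (qpoch x p n / qpoch p p n)); last first.
  by field; rewrite P0 pn.
rewrite -IHn mulr_sumr mulrBl mul1r mulr_sumr.
pose t k := (-1) ^+ k * p ^+ 'C(k, 2) * x ^+ k
  / (qpoch p p k * qpoch p p (n.+1 - k)) : C.
have E (k : 'I_n.+2) : true -> (1 - p ^+ n.+1) * t k
   = (1 - p ^+ (n.+1 - k)) * t k + p ^+ (n.+1 - k) * (1 - p ^+ k) * t k.
  move=> _.
  have -> : p ^+ n.+1 = p ^+ (n.+1 - k) * p ^+ k.
    by rewrite -exprD subnK // -ltnS.
  ring.
rewrite (eq_bigr _ E) big_split /=; congr (_ + _).
  rewrite big_ord_recr /= subnn expr0 subrr mul0r addr0.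
  apply: eq_bigr => k _; rewrite /t subSn ?(ltnSE (ltn_ord k)) // qpochS -exprS.
  have := p1 (n - k).+1 isT; have := P0 k; have := P0 (n - k)%N.
  by move=> h1 h2 h3; field; rewrite h1 h2 h3.
rewrite big_ord_recl /= expr0 subrr mulr0 mul0r add0r -sumrN.
apply: eq_bigr => k _; rewrite /t /bump /= add1n subSS qpochS -exprS.
have -> : p ^+ n = p ^+ (n - k) * p ^+ k by rewrite -exprD subnK // -ltnS.
rewrite binS bin1 !exprS exprD.
have := p1 k.+1 isT; have := P0 k; have := P0 (n - k)%N.
move: (_ - k)%N => j; rewrite exprS => h1 h2 h3.
by field; rewrite h1 h2 h3.
Qed.

(** At [x = p^(-n)] this is a terminating basic hypergeometric series [2phi1]
    in base [p^2], with lower parameter [0]. *)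
Definition even_sum p x J : C :=
  \sum_(j < J) p ^+ (2 * j) * qpoch x p (2 * j) / qpoch (p ^+ 2) (p ^+ 2) j.

(** The difference telescopes: its term of index [j] is [A_(j+1) - A_j] with
    [A_j = (x; p)_(2j-1) / (p^2; p^2)_(j-1)]. At [x = q^n] with [q = p^-1] the
    right-hand side vanishes for large [J], so that the sums at [q^(n+1)] and
    at [q^n] differ by the factor [q^n], as the moments do up to sign. *)
Lemma even_sum_shift p x J : p != 0 ->
  (forall k, (0 < k)%N -> 1 - p ^+ k != 0) ->
  even_sum p (x / p) J.+1 - x * even_sum p x J.+1 =
  qpoch x p (2 * J).+1 / qpoch (p ^+ 2) (p ^+ 2) J.
Proof.
move=> p0 p1.
have P0 k : qpoch (p ^+ 2) (p ^+ 2) k != 0.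
  by apply: qpoch_neq0 => j j0; rewrite -exprM p1 // muln_gt0.
elim: J => [|J IHJ].
  by rewrite /even_sum !big_ord1 qpochS !qpoch0; field.
rewrite /even_sum big_ord_recr [in X in _ - x * X]big_ord_recr /=.
rewrite -/(even_sum p (x / p) J.+1) -/(even_sum p x J.+1) mulrDr.
rewrite opprD addrACA IHJ.
have -> : (2 * J.+1)%N = (2 * J).+2 by lia.
rewrite qpochSl // !(qpochS x) (qpochS (p ^+ 2)) -exprS -exprM.
have := p1 (2 * J.+1)%N isT.
have -> : (2 * J.+1)%N = (2 * J).+2 by lia.
have := P0 J; move: (qpoch x p _) => A; move: (qpoch _ _ J) => B.
rewrite !exprS; move: (p ^+ (2 * J)) => y h1 h2.
by field; rewrite h1 h2 p0.
Qed.

Lemma qpoch_vanish q n N : q != 0 -> (n < N)%N -> qpoch (q ^+ n) q^-1 N = 0.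
Proof.
move=> q0 nN; rewrite /qpoch (bigD1_seq n.+1) ?iota_uniq ?mem_index_iota //=.
by rewrite exprVn divff ?expf_neq0 // subrr mul0r.
Qed.

Lemma even_sum_eval q n J : q != 0 ->
  (forall k, (0 < k)%N -> 1 - q^-1 ^+ k != 0) -> (n < J)%N ->
  even_sum q^-1 (q ^+ n) J = q ^+ 'C(n, 2).
Proof.
move=> q0 p1; have p0 : q^-1 != 0 by rewrite invr_eq0.
case: J => // J; elim: n => [|n IHn] nJ.
  rewrite /even_sum big_ord_recl /= muln0 !qpoch0 !expr0 divr1 mulr1.
  rewrite big1 ?addr0 // => j _; rewrite -[1]/(q ^+ 0).
  by rewrite qpoch_vanish ?muln_gt0 // mulr0 mul0r.
have := even_sum_shift (q ^+ n) J p0 p1.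
rewrite qpoch_vanish // ?mul0r; last by lia.
rewrite invrK -exprSr IHn 1?ltnW // => /eqP; rewrite subr_eq0 => /eqP->.
by rewrite -exprD binS bin1 addnC.
Qed.

Lemma epsilonSS q j :
  epsilon q j.+1.*2 = epsilon q j.*2 * (q ^+ j.*2 * (q ^+ j.*2.+1 - 1)).
Proof.
rewrite /epsilon !odd_double !doubleK [in LHS]big_nat_recr //=.
have -> : (j.+1 * (j.+1 - 1))%N = (j * (j - 1) + j.*2)%N by nia.
have -> : (j.+1.*2 - 1)%N = j.*2.+1 by lia.
by rewrite exprD; ring.
Qed.

(** This is where the choice of [epsilon] matters: the odd-indexed factors of
    [(p; p)_(2j)] cancel, which leaves a base [p^2] series. *)
Lemma epsilon_qpoch q j : q != 0 ->
  (forall k, (0 < k)%N -> 1 - q^-1 ^+ k != 0) ->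
  epsilon q j.*2 * q^-1 ^+ 'C(j.*2.+1, 2) / qpoch q^-1 q^-1 j.*2 =
  q^-1 ^+ (2 * j) / qpoch (q^-1 ^+ 2) (q^-1 ^+ 2) j.
Proof.
move=> q0 p1; elim: j => [|j IHj].
  by rewrite !qpoch0 /epsilon /= big_nil !expr0 !mulr1.
move: IHj; set p := q^-1; have p0 : p != 0 by rewrite invr_eq0.
rewrite !mul2n; set y := p ^+ j.*2.
have y0 : y != 0 by rewrite expf_neq0.
have E1 : p ^+ 'C(j.+1.*2.+1, 2) =
    p ^+ 'C(j.*2.+1, 2) * (y * p) * (y * p * p).
  by rewrite doubleS 2!(bin2S _.+1) !exprD -!exprSr.
have E2 : epsilon q j.+1.*2 = epsilon q j.*2 * (y^-1 * (y^-1 * p^-1 - 1)).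
  by rewrite epsilonSS /y exprVn !invrK -exprSr.
have E3 : qpoch p p j.+1.*2 =
    qpoch p p j.*2 * (1 - y * p) * (1 - y * p * p).
  by rewrite doubleS !qpochS -!exprS -!exprSr.
have E4 : p ^+ j.+1.*2 = y * p * p by rewrite doubleS !exprSr.
have E5 : qpoch (p ^+ 2) (p ^+ 2) j.+1 =
    qpoch (p ^+ 2) (p ^+ 2) j * (1 - y * p * p).
  by rewrite qpochS -exprM -exprD add2n mul2n !exprSr.
have A0 := qpoch_neq0 j.*2 p1.
have B0 : qpoch (p ^+ 2) (p ^+ 2) j != 0.
  by apply: qpoch_neq0 => k k0; rewrite -exprM p1 // muln_gt0.
have h1 : 1 - y * p != 0 by rewrite -exprSr p1.
have h2 : 1 - y * p * p != 0 by rewrite -!exprSr p1.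
rewrite E1 E2 E3 E4 E5 => IH.
transitivity (epsilon q j.*2 * p ^+ 'C(j.*2.+1, 2) / qpoch p p j.*2
  * (p * p / (1 - y * p * p))); last by rewrite IH; field; rewrite h2 B0.
by field; rewrite A0 h1 h2 p0 y0.
Qed.
Lemma sum_triangle (F : nat -> nat -> C) K :
  \sum_(k < K) \sum_(m < K - k) F k m =
  \sum_(N < K) \sum_(k < N.+1) F k (N - k)%N.
Proof.
elim: K => [|K IHK]; first by rewrite !big_ord0.
rewrite [RHS]big_ord_recr /= -IHK.
transitivity (\sum_(k < K.+1) (\sum_(m < K - k) F k m + F k (K - k)%N)).
  by apply: eq_bigr => k _; rewrite subSn ?big_ord_recr // -ltnS.
by rewrite big_split /= big_ord_recr /= subnn big_ord0 addr0.
Qed.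

Lemma sum_ord_double (f : nat -> C) K :
  (forall j, f j.*2.+1 = 0) -> \sum_(N < K.*2) f N = \sum_(j < K) f j.*2.
Proof.
move=> f0; elim: K => [|K IHK]; first by rewrite !big_ord0.
by rewrite doubleS !big_ord_recr /= f0 addr0 IHK.
Qed.

Lemma sum_ord_widen0 (f : nat -> C) K L : (K <= L)%N ->
  (forall N, (K <= N)%N -> f N = 0) -> \sum_(N < L) f N = \sum_(N < K) f N.
Proof.
move=> KL f0; rewrite -!(big_mkord predT) (big_cat_nat (n := K)) //=.
rewrite [X in _ + X]big_nat_cond [X in _ + X]big1 ?addr0 // => N.
by rewrite andbT => /andP[/f0].
Qed.

(** The term of index [(k, m)] of the double series obtained by expanding the
    weight of index [k], multiplied by [q^(k n)]; the latter is, up to sign, the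
    value of [x^(2n)] at the points of index [k]. *)
Definition moment_term q n k m : C :=
  (-1) ^+ k * q ^- (k ^ 2) * q ^+ (k * n) / qpoch q^-1 q^-1 k * s_term q k m.

(** The exponents combine because
    [k^2 + C(m+1, 2) + k m = C(m+k+1, 2) + C(k, 2)]: apart from a factor
    depending on [m + k] only, the term is one of the q-binomial theorem. *)
Lemma moment_termE q n k m :
  moment_term q n k m = epsilon q (m + k) * q^-1 ^+ 'C((m + k).+1, 2) *
    ((-1) ^+ k * q^-1 ^+ 'C(k, 2) * (q ^+ n) ^+ k
      / (qpoch q^-1 q^-1 k * qpoch q^-1 q^-1 m)).
Proof.
rewrite /moment_term /s_term.
have -> : ((m * (m + 1))./2 = 'C(m.+1, 2))%N by rewrite bin2 mulnC addn1.
rewrite -!exprVn [(k * n)%N]mulnC exprM invfM.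
have E : q^-1 ^+ (k ^ 2) * q^-1 ^+ ('C(m.+1, 2) + k * m) =
  q^-1 ^+ 'C((m + k).+1, 2) * q^-1 ^+ 'C(k, 2).
  rewrite -!exprD; congr (_ ^+ _); rewrite -addSn bin2D sqr_bin2 bin2S; nia.
transitivity ((-1) ^+ k * (q ^+ n) ^+ k / qpoch q^-1 q^-1 k
  / qpoch q^-1 q^-1 m * epsilon q (m + k) *
   (q^-1 ^+ (k ^ 2) * q^-1 ^+ ('C(m.+1, 2) + k * m))); first by ring.
by rewrite E; ring.
Qed.

Lemma moment_term_diagonal q n N :
  (forall k, (0 < k)%N -> 1 - q^-1 ^+ k != 0) ->
  \sum_(k < N.+1) moment_term q n k (N - k) =
  epsilon q N * q^-1 ^+ 'C(N.+1, 2) / qpoch q^-1 q^-1 N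
    * qpoch (q ^+ n) q^-1 N.
Proof.
move=> p1; rewrite -[RHS]mulrA [_^-1 * _]mulrC -q_binomial // mulr_sumr.
by apply: eq_bigr => k _; rewrite moment_termE subnK // -ltnS.
Qed.

(** The triangular partial sums are eventually constant: the diagonals of index
    beyond [n] vanish with [(q^n; q^-1)_N]. *)
Lemma moment_term_triangle q n K : q != 0 ->
  (forall k, (0 < k)%N -> 1 - q^-1 ^+ k != 0) -> (n < K)%N ->
  \sum_(k < K) \sum_(m < K - k) moment_term q n k m = q ^+ 'C(n, 2).
Proof.
move=> q0 p1 nK; rewrite sum_triangle.
pose f N := epsilon q N * q^-1 ^+ 'C(N.+1, 2) / qpoch q^-1 q^-1 N
    * qpoch (q ^+ n) q^-1 N.
transitivity (\sum_(N < K) f N).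
  by apply: eq_bigr => N _; rewrite moment_term_diagonal.
rewrite -(@sum_ord_widen0 f K K.*2) -?addnn ?leq_addr // => [|N KN]; last first.
  by rewrite /f qpoch_vanish ?mulr0 // (leq_trans nK).
rewrite addnn sum_ord_double; last first.
  by move=> j; rewrite /f /epsilon /= odd_double !mul0r.
rewrite -(even_sum_eval q0 p1 nK); apply: eq_bigr => j _.
by rewrite /f epsilon_qpoch // mulrAC mul2n.
Qed.
End QSeries.

(** * Bounds on the double series *)

Section Bounds.
Variable R : realType.
Local Notation C := R[i].
Implicit Types (q : C) (x y : R).

Lemma real_complexX y n : (y ^+ n)%:C = y%:C ^+ n :> C.
Proof. exact: rmorphXn. Qed.

Lemma real_complexM x y : (x * y)%:C = x%:C * y%:C :> C.
Proof. exact: rmorphM. Qed.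

Lemma norm_real_complex y : `|y%:C| = `|y|%:C :> C.
Proof.
by rewrite normc_def /= expr0n addr0 sqrtr_sqr.
Qed.

Lemma geometric_sum_le y n : 0 <= y < 1 -> \sum_(i < n) y ^+ i <= (1 - y)^-1.
Proof.
move=> /andP[y0 y1]; have y1' : 0 < 1 - y by rewrite subr_gt0.
rewrite -[leRHS]mul1r ler_pdivlMr // mulrC -opprB mulNr -subrX1 opprB.
by rewrite gerBl exprn_ge0.
Qed.

Lemma inv_one_sub_le_exp y z : 0 <= z <= y -> y < 1 ->
  (1 - z)^-1 <= expR (z / (1 - y)).
Proof.
move=> /andP[z0 zy] y1; apply: le_trans (expR_ge1Dx _).
have y1' : 0 < 1 - y by rewrite subr_gt0.
have z1' : 0 < 1 - z by lra.
have -> : (1 - z)^-1 = 1 + z / (1 - z) by field; rewrite lt0r_neq0.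
by rewrite lerD2l ler_wpM2l // lef_pV2 ?posrE //; lra.
Qed.

(** With [y = x^-1], the product [(y; y)_k] stays away from [0], because
    [(1 - z)^-1 <= exp (z / (1 - y))] for [0 <= z <= y] and the [y^i] are
    summable. *)
Lemma qpoch_inv_bounded x : 1 < x ->
  exists2 D, 0 <= D &
    forall k, `|(qpoch (x%:C)^-1 (x%:C)^-1 k)^-1| <= D%:C :> C.
Proof.
move=> x1; have x0 : 0 < x by apply: lt_trans x1.
set y := x^-1; have y01 : 0 < y < 1 by rewrite invr_gt0 x0 invf_lt1.
have -> : (x%:C)^-1 = y%:C :> C by rewrite /y fmorphV.
clearbody y; exists (expR ((1 - y)^-1 / (1 - y))); first exact: expR_ge0.
move=> k; case/andP: y01 => y0 y1.
have y1' : 0 < 1 - y by rewrite subr_gt0.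
apply: (@le_trans _ _ (expR ((\sum_(i < k) y ^+ i.+1) / (1 - y)))%:C); last first.
  rewrite lecR ler_expR ler_wpM2r ?invr_ge0 ?(ltW y1') //.
  apply: le_trans (geometric_sum_le k _); last by rewrite (ltW y0).
  by apply: ler_sum => i _; rewrite exprS ler_piMl ?exprn_ge0 ?ltW.
elim: k => [|k IHk].
  by rewrite qpoch0 big_ord0 mul0r expR0 invr1 normr1.
have yk : 0 <= y ^+ k.+1 <= y.
  by rewrite exprn_ge0 ?(ltW y0) // exprS ler_piMr ?exprn_ile1 ?(ltW y0) ?(ltW y1).
rewrite qpochS invfM normrM big_ord_recr /= mulrDl expRD real_complexM.
apply: ler_pM => //.
have -> : (1 - y%:C * y%:C ^+ k)^-1 = ((1 - y ^+ k.+1)^-1)%:C :> C.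
  by rewrite fmorphV rmorphB rmorph1 /= real_complexX exprS.
rewrite norm_real_complex lecR ger0_norm ?inv_one_sub_le_exp //.
by rewrite invr_ge0 subr_ge0; lra.
Qed.

(** Replace each factor [q^(2i-1) - 1] by [q^(2i-1)]. *)
Lemma epsilon_le q N : 1 < q -> `|epsilon q N| <= q ^+ 'C(N, 2).
Proof.
move=> q1; have q0 : 0 <= q by apply: le_trans (ltW q1).
rewrite -(odd_double_half N); case: (odd N); rewrite ?add1n ?add0n.
  by rewrite /epsilon /= odd_double normr0 exprn_ge0.
elim: N./2 => [|j IHj]; first by rewrite /epsilon /= big_nil mulr1 normr1.
rewrite epsilonSS doubleS !bin2S !exprD -mulrA normrM ler_pM //.
rewrite normrM normrX ger0_norm // ler_wpM2l ?exprn_ge0 //.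
rewrite ger0_norm ?subr_ge0 ?exprn_ege1 ?(ltW q1) //.
by rewrite lerBlDr lerDl.
Qed.

(** The factor [x^(- C(k, 2))] beats the growth [x^(k n)]. The decay in [k] is
    recorded with the rate [x^(-2 k)], twice that in [m], because a tail
    estimate along diagonals consumes half of it. *)
Lemma moment_term_le x n : 1 < x ->
  exists2 D, 0 <= D & forall k m,
    `|moment_term x%:C n k m| <= (D * x^-1 ^+ (2 * k + m))%:C.
Proof.
move=> x1; have x0 : 0 < x by apply: lt_trans x1.
have [D D0 PD] := qpoch_inv_bounded x1.
have [M nM] : exists M, forall k, (n * k + k <= M + 'C(k, 2))%N.
  (* k^2 / 2 - (n + 3/2) k + (n + 2)^2 has negative discriminant. *)
  by exists ((n + 2) ^ 2)%N => k; have := sqr_bin2 k; rewrite bin2S; nia.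
exists (x ^+ M * D ^+ 2) => [|k m].
  by rewrite mulr_ge0 // exprn_ge0 // ltW.
have q0 : 0 < x%:C :> C by rewrite ltcR.
have q1 : 1 < x%:C :> C by rewrite ltcR.
have y0 : 0 < x^-1 by rewrite invr_gt0.
have xyK a : x ^+ a * x^-1 ^+ a = 1 by rewrite -exprMn divff ?expr1n ?gt_eqF.
apply: (@le_trans _ _ (x%:C ^+ 'C(m + k, 2) * (x^-1 ^+ 'C((m + k).+1, 2))%:C
    * ((x^-1 ^+ 'C(k, 2))%:C * (x%:C ^+ n) ^+ k * (D%:C * D%:C)))).
  rewrite moment_termE invfM !normrM !normrX normrN normr1 expr1n mul1r.
  have -> : `|(x%:C)^-1| = (x^-1)%:C :> C.
    by rewrite -fmorphV /= norm_real_complex gtr0_norm.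
  rewrite !real_complexX norm_real_complex (gtr0_norm x0).
  have yC0 : 0 <= (x^-1)%:C :> C by rewrite lecR ltW.
  by rewrite !ler_pM ?mulr_ge0 ?normr_ge0 ?exprn_ge0 ?yC0 ?(ltW q0) ?epsilon_le.
rewrite -!real_complexX -!real_complexM lecR.
have /(ler_weXn2l (ltW x1)) := nM k.
rewrite mul2n -addnn !(exprD x) bin2S !(exprD x^-1) => le_kn.
rewrite -exprM; have := xyK 'C(m + k, 2); have := xyK 'C(k, 2); have := xyK k.
have : 0 <= x^-1 ^+ k by rewrite exprn_ge0 // ltW.
have : 0 <= x^-1 ^+ m by rewrite exprn_ge0 // ltW.
have : 0 <= x^-1 ^+ 'C(k, 2) by rewrite exprn_ge0 // ltW.
move: le_kn; move: (x ^+ 'C(m + k, 2)) (x^-1 ^+ 'C(m + k, 2)) => a a'.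
move: (x ^+ k) (x^-1 ^+ k) (x ^+ 'C(k, 2)) (x^-1 ^+ 'C(k, 2)) => b b' c c'.
move: (x ^+ _) (x ^+ _) (x^-1 ^+ _) => Y X d le_kn c0 d0 b0 bb cc aa.
have -> : a * (a' * (d * b')) * (c' * X * (D * D)) =
    D ^+ 2 * b' ^+ 2 * d * c' * (X * b)
    + ((a * a') - b * b') * (D ^+ 2 * b' * d * c' * X).
  by ring.
have -> : Y * D ^+ 2 * (b' * b' * d) =
    D ^+ 2 * b' ^+ 2 * d * c' * (Y * c)
    + (1 - c * c') * (Y * D ^+ 2 * b' ^+ 2 * d).
  by ring.
rewrite aa bb cc subrr !mul0r !addr0.
by rewrite ler_wpM2l // !mulr_ge0 ?exprn_ge0.
Qed.
End Bounds.

(** * Dominated complex series *)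

Section Limits.
Variable R : realType.
Local Notation C := R[i].

Lemma complex_gt0_re (e : C) : 0 < e -> exists2 d : R, 0 < d & e = d%:C.
Proof.
case: e => a b; rewrite ltcE /= => /andP[/eqP-> a0]; exists a => //.
Qed.

Lemma cvg_real_complex (f : nat -> R) (l : R) :
  f @ \oo --> l -> ((f n)%:C : C^o) @[n --> \oo] --> (l%:C : C^o).
Proof.
move=> /cvgrPdist_lt fl; apply/cvgrPdist_lt => e /complex_gt0_re[d d0 ->].
near=> n; rewrite -rmorphB /= norm_real_complex ltcR.
by near: n; exact: fl.
Unshelve. all: by end_near. Qed.

Lemma is_cvg_dominated_series (a : nat -> R) (D p : R) : 0 <= p < 1 ->
  (forall m, `|a m| <= D * p ^+ m) -> cvgn (series a).
Proof.
move=> /andP[p0 p1] aD; apply: normed_cvg.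
apply: (@series_le_cvg _ _ (geometric D p)) => //=.
- by move=> n; apply: le_trans (aD n).
- by apply: is_cvg_geometric_series; rewrite ger0_norm.
Qed.

Lemma normc_ge_Im (z : C) : `|complex.Im z|%:C <= `|z|.
Proof.
rewrite normc_def lecR -sqrtr_sqr ler_wsqrtr //; by rewrite lerDr sqr_ge0.
Qed.

(** Completeness is used in the real line, for the real and imaginary parts. *)
Lemma is_cvg_dominated_complex_series (a : nat -> C^o) (D p : R) : 0 <= p < 1 ->
  (forall m, `|a m| <= (D * p ^+ m)%:C) -> cvgn (series a).
Proof.
move=> p01 aD.
have cRe : cvgn (series (fun m => complex.Re (a m))).
  apply: (is_cvg_dominated_series (D := D) p01) => m; rewrite -lecR.
  exact: le_trans (normc_ge_Re _) (aD m).
have cIm : cvgn (series (fun m => complex.Im (a m))).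
  apply: (is_cvg_dominated_series (D := D) p01) => m; rewrite -lecR.
  exact: le_trans (normc_ge_Im _) (aD m).
have -> : series a = (fun n => (series (fun m => complex.Re (a m)) n)%:C : C^o)
    \+ ('i%C : C) \*: (fun n => (series (fun m => complex.Im (a m)) n)%:C : C^o).
  apply/funext => n; rewrite /series /= !rmorph_sum /= scaler_sumr -big_split /=.
  by apply: eq_bigr => i _; rewrite [LHS]complexE.
apply: is_cvgD; first exact: (cvgP _ (cvg_real_complex cRe)).
by apply: is_cvgZl_tmp; exact: (cvgP _ (cvg_real_complex cIm)).
Qed.

(** Row [k] of the difference starts at [m = K - k], so that its terms are at
    most [D p^(K + k)] times powers of [p]. *)
Lemma iterated_series_tail (a : nat -> nat -> C^o) (D p : R) K M :
  0 <= D -> 0 <= p < 1 ->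
  (forall k m, `|a k m| <= (D * p ^+ (2 * k + m))%:C) -> (K <= M)%N ->
  `|\sum_(k < K) \sum_(m < M) a k m - \sum_(k < K) \sum_(m < K - k) a k m|
    <= (D / (1 - p) / (1 - p) * p ^+ K)%:C.
Proof.
move=> D0 p01 aD KM; have /andP[p0 p1] := p01.
rewrite -sumrB; apply: le_trans (ler_norm_sum _ _ _) _.
have p1' : 0 < (1 - p)^-1 by rewrite invr_gt0 subr_gt0.
apply: (@le_trans _ _ (\sum_(k < K) (D / (1 - p) * p ^+ K * p ^+ k)%:C)).
  apply: ler_sum => k _; rewrite -!(big_mkord predT).
  rewrite (big_cat_nat (n := K - k)) ?(leq_trans (leq_subr _ _)) //=.
  rewrite addrAC subrr add0r.
  rewrite -{1}[(K - k)%N]add0n big_addn big_mkord.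
  apply: le_trans (ler_norm_sum _ _ _) _.
  apply: (@le_trans _ _ (\sum_(i < M - (K - k)) (D * p ^+ (K + k) * p ^+ i)%:C)).
    apply: ler_sum => i _; apply: le_trans (aD _ _) _.
    rewrite lecR -mulrA -exprD.
    suff -> : (2 * k + (i + (K - k)) = K + k + i)%N by [].
    by have := ltn_ord k; lia.
  rewrite -rmorph_sum lecR -mulr_sumr exprD.
  have := geometric_sum_le (M - (K - k)) p01.
  move=> /(ler_wpM2l (_ : 0 <= D * (p ^+ K * p ^+ k))) le.
  apply: le_trans (le _) _; first by rewrite !mulr_ge0 ?exprn_ge0.
  by rewrite le_eqVlt; apply/orP; left; apply/eqP; ring.
rewrite -rmorph_sum lecR -mulr_sumr.
rewrite [leRHS]mulrAC ler_wpM2l ?geometric_sum_le //.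
by rewrite !mulr_ge0 ?exprn_ge0 // ltW.
Qed.

(** The interchange of summations: sums over [K] rows cut at any number
    [M >= K] of columns differ from the triangular sum [L] by [O(p^K)],
    uniformly in [M], hence so does the sum of the first [K] row series. *)
Lemma iterated_series_cvg (a : nat -> nat -> C^o) (D p : R) (L : C^o) K0 :
  0 <= D -> 0 <= p < 1 ->
  (forall k m, `|a k m| <= (D * p ^+ (2 * k + m))%:C) ->
  (forall K, (K0 < K)%N -> \sum_(k < K) \sum_(m < K - k) a k m = L) ->
  (forall k, cvgn (series (a k))) /\
  series (fun k => limn (series (a k))) @ \oo --> L.
Proof.
move=> D0 p01 aD aL; have /andP[p0 p1] := p01.
have ca k : cvgn (series (a k)).
  apply: (is_cvg_dominated_complex_series (D := D * p ^+ (2 * k)) p01) => m.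
  by rewrite -mulrA -exprD.
split=> //; apply/cvgrPdist_lt => e /complex_gt0_re[d d0 ->].
set B := D / (1 - p) / (1 - p).
have cB : geometric B p @ \oo --> (0 : R) by apply: cvg_geometric; rewrite ger0_norm.
have d2 : 0 < d / 2 by rewrite divr_gt0.
have /cvgrPdist_lt/(_ _ d2) cB' := cB.
near=> K.
have cK : (fun M => \sum_(k < K) series (a k) M) @ \oo -->
    series (fun k => limn (series (a k))) K.
  rewrite /series /= big_mkord.
  apply: cvg_big => [|k _]; [exact: add_continuous | exact: ca].
have d2C : 0 < (d / 2)%:C :> C by rewrite ltcR.
have /cvgrPdist_lt/(_ _ d2C) cK' := cK.
have [M /= KM HM] : exists2 M, (K <= M)%N &
    `|series (fun k => limn (series (a k))) K
      - \sum_(k < K) series (a k) M| < (d / 2)%:C.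
  near \oo => M; exists M; near: M => //; exact: nbhs_infty_ge.
have := iterated_series_tail D0 p01 aD KM.
rewrite aL; last by near: K; exact: nbhs_infty_gt.
set S := \sum_(k < K) _ => SL.
have -> : L - series (fun k => limn (series (a k))) K =
    (L - S) + (S - series (fun k => limn (series (a k))) K).
  by rewrite addrA subrK.
apply: le_lt_trans (ler_normD _ _) _; rewrite [d]splitr rmorphD /=.
apply: ler_ltD; last first.
  rewrite distrC (_ : S = \sum_(k < K) series (a k) M) //.
  by apply: eq_bigr => k _; rewrite /series /= big_mkord.
rewrite distrC; apply: le_trans SL _; rewrite lecR ltW //.
apply: le_lt_trans (ler_norm _) _; rewrite -normrN -sub0r.
by near: K; exact: cB'.
Unshelve. all: by end_near. Qed.
End Limits.

(** * The discrete representation *)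

Section DiscreteRepresentation.
Variable R : realType.
Local Notation C := R[i].
Implicit Types (q : C) (u : {scalar {poly C}}).

Lemma nonroot_inv q k : nonroot q -> (0 < k)%N -> 1 - q^-1 ^+ k != 0.
Proof.
case=> q0 q1 k0; rewrite exprVn subr_eq0 eq_sym invr_eq1; exact: q1.
Qed.

Lemma moment_series_cvg q : nonroot q -> 1 < q -> forall n,
  (forall k, cvgn (series (moment_term q n k : nat -> C^o))) /\
  series (fun k => limn (series (moment_term q n k : nat -> C^o))) @ \oo
    --> (q ^+ 'C(n, 2) : C^o).
Proof.
move=> hq q1 n; have [q0 _] := hq; have p1 k := @nonroot_inv q k hq.
have [x x0 qE] := complex_gt0_re (lt_trans ltr01 q1).
have x1 : 1 < x by move: q1; rewrite qE ltcR.
have [D D0 le_D] := moment_term_le n x1.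
apply: (@iterated_series_cvg _ _ D x^-1 _ n D0) => [|k m|K nK].
- by rewrite invr_ge0 ltW //= invf_lt1.
- by rewrite qE.
- exact: moment_term_triangle.
Qed.

Lemma s_term_cvg q k : nonroot q -> 1 < q -> cvgn (series (s_term q k)).
Proof.
move=> hq q1; have [q0 _] := hq; have p1 j := @nonroot_inv q j hq.
have [/(_ k) ck _] := moment_series_cvg hq q1 0.
pose c : C := (-1) ^+ k * q ^- (k ^ 2) * q ^+ (k * 0) / qpoch q^-1 q^-1 k.
have c0 : c != 0.
  by rewrite !mulf_neq0 ?invr_eq0 ?expf_neq0 ?oppr_eq0 ?oner_neq0 ?qpoch_neq0.
have -> : series (s_term q k) = c^-1 \*: series (moment_term q 0 k : nat -> C^o).
  apply/funext => m; rewrite /series /= scaler_sumr; apply: eq_bigr => i _.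
  by rewrite /moment_term -/c [RHS]mulKf.
exact: is_cvgZl_tmp.
Qed.

Lemma weight_moment q n k : nonroot q -> 1 < q ->
  limn (series (moment_term q n k : nat -> C^o)) = weight q k * q ^+ (k * n).
Proof.
move=> hq q1.
pose c : C :=
  (-1) ^+ k * q ^- (k ^ 2) * q ^+ (k * n) / qpoch q^-1 q^-1 k.
have -> : series (moment_term q n k : nat -> C^o) = c \*: series (s_term q k).
  by apply/funext => m; rewrite /series /= scaler_sumr.
rewrite limZl_tmp; last exact: s_term_cvg.
by rewrite /weight /s_sum /c /GRing.scale /=; ring.
Qed.

Lemma symmetric_dirac_odd q k n : symmetric_dirac q k 'X^(n.*2.+1) = 0.
Proof.
by rewrite /symmetric_dirac !hornerXn exprNn -signr_odd /= odd_double mulN1r subrr mul0r.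
Qed.

Lemma symmetric_dirac_even q k n :
  symmetric_dirac q k 'X^(n.*2) = (-1) ^+ n * q ^+ (k * n).
Proof.
have zz : ('i%C * sqrtc q ^+ k) ^+ 2 = - q ^+ k.
  by rewrite exprMn sqr_i mulN1r -exprM mulnC exprM sqr_sqrtc.
rewrite /symmetric_dirac !hornerXn -mul2n !exprM sqrrN zz [(- q ^+ k) ^+ n]exprNn.
by field.
Qed.

Lemma poly_linear_ind (P : {poly C} -> Prop) :
  (forall c g h, P g -> P h -> P (c *: g + h)) -> (forall n, P 'X^n) ->
  forall f, P f.
Proof.
move=> Plin PX f; rewrite -(coefK f) poly_def.
apply: (big_rec P) => [|i g _ Pg]; last exact: Plin.
by rewrite -(addNr ('X^0 : {poly C})) -scaleN1r; exact: Plin.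
Qed.

Lemma discrete_term_linear q (c : C) (f g : {poly C}) k :
  discrete_term q (c *: f + g) k =
  c * discrete_term q f k + discrete_term q g k.
Proof. by rewrite /discrete_term /symmetric_dirac !hornerD !hornerZ; ring. Qed.

Lemma discrete_term_cvg q u : nonroot q -> 1 < q -> symmetrical u ->
  (forall n, moment u n.*2 = (-1) ^+ n * q ^+ 'C(n, 2)) ->
  forall f : {poly C}, series (discrete_term q f) @ \oo --> (u f : C^o).
Proof.
move=> hq q1 su mu f.
pose P (f : {poly C}) := series (discrete_term q f) @ \oo --> (u f : C^o).
have Plin c g h : P g -> P h -> P (c *: g + h).
  move=> Pg Ph; rewrite /P.
  have -> : series (discrete_term q (c *: g + h)) =
      c \*: series (discrete_term q g) \+ series (discrete_term q h).
    apply/funext => n; rewrite /series /= scaler_sumr -big_split /=.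
    by apply: eq_bigr => k _; rewrite discrete_term_linear.
  have -> : u (c *: g + h) = c *: (u g : C^o) + (u h : C^o).
    by rewrite linearD /= formZ.
  by apply: cvgD Ph; apply: cvgZl_tmp.
have PX n : P 'X^n.
  rewrite /P -/(moment u n) -(odd_double_half n); case: (odd n); rewrite ?add1n ?add0n.
    rewrite su; have -> : series (discrete_term q 'X^(n./2.*2.+1)) = cst 0.
      apply/funext => m; rewrite /series /= big1 // => k _.
      by rewrite /discrete_term symmetric_dirac_odd mulr0.
    exact: cvg_cst.
  have [_ cX] := moment_series_cvg hq q1 n./2.
  have -> : series (discrete_term q 'X^(n./2.*2)) = ((-1) ^+ n./2 : C) \*:
      series (fun k => limn (series (moment_term q n./2 k : nat -> C^o))).
    apply/funext => m; rewrite /series /= scaler_sumr; apply: eq_bigr => k _.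
    by rewrite weight_moment // /discrete_term symmetric_dirac_even mulrCA.
  by rewrite mu; exact: cvgZl_tmp.
exact: (@poly_linear_ind P Plin PX f).
Qed.
End DiscreteRepresentation.

Theorem proposition3 (R : realType) (q : R[i]) (hq : nonroot q)
  (U : {scalar {poly R[i]}}) (hU0 : moment U 0 = 1)
  (hU : H_equation q U 'X (- ((q - 1)^-1 *: ('X + 1))))
  (u : {scalar {poly R[i]}}) (hsym : symmetrical u)
  (hsigma : sigma_form u =1 U) :
  (forall B : nat -> {poly R[i]}, is_MOPS u B ->
     exists2 gamma : nat -> R[i], recurrence B (fun=> 0) gamma &
       forall n : nat,
         gamma (2 * n + 1)%N = - q ^+ (2 * n) /\
         gamma (2 * n + 2)%N = (1 - q ^+ n.+1) * q ^+ n) /\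
  regular u /\
  semiclassical_of_class (sqrtc q) u 'X
    (- ((sqrtc q - 1)^-1 *: ('X^2 + 1))) 1 /\
  (forall n : nat,
     moment u (2 * n) = (-1) ^+ n * q ^+ ((n * (n - 1))./2) /\
     moment u (2 * n + 1) = 0) /\
  (1 < q ->
     (forall k : nat, cvgn (series (s_term q k))) /\
     (forall f : {poly R[i]},
        series (discrete_term q f) @ \oo --> (u f : R[i]^o))).
Proof.
have [q0 qn] := hq; have q1 : q != 1 by rewrite -[q]expr1 qn.
have mU := moment_U q1 hU0 hU.
have mu n : moment u n.*2 = (-1) ^+ n * q ^+ 'C(n, 2).
  by rewrite (moment_sigma _ hsigma).
have [MS normS] := sympoly_MOPS hq hsym hsigma mU.
have r1 : sqrtc q != 1.
  by apply: contraNneq q1 => r1; rewrite -[q]sqr_sqrtc r1 expr1n.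
split=> [B MB|].
  have BS := MOPS_unique MB MS.
  have uB n : u (B n * B n) = symnorm q n by rewrite BS normS.
  exists (fun n => u (B n * B n) / u (B n.-1 * B n.-1)).
    by apply: MOPS_recurrence => // n; rewrite BS sympoly_parity.
  move=> n; rewrite !uB addn1 addn2 mul2n /= -doubleS.
  by rewrite symnorm_odd // symnorm_even // mul2n.
split; first by exists (sympoly q).
split.
  split; first by exists (sympoly q).
  - split; first exact: monicX.
    rewrite size_polyN size_scale ?invr_eq0 ?subr_eq0 //.
    by rewrite -polyC1 size_XnaddC.
  - exact: (symmetric_equation r1 (sqr_sqrtc q) hsym hsigma mU).
  - rewrite size_polyN size_scale ?invr_eq0 ?subr_eq0 //.
    by rewrite -polyC1 size_XnaddC // size_polyX.
  - exact: symmetric_class.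
split=> [n|lt1q]; last split=> [k|f].
- rewrite mul2n mu bin2 subn1 addn1; split=> //; exact: hsym.
- exact: s_term_cvg.
- exact: discrete_term_cvg.
Qed.
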